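(* Let $A,B\in\mathcal{L}(\mathcal{H})$ have closed ranges and satisfy $\mathcal{R}((B-A)^\dagger)=\mathcal{R}(B^\dagger-A^\dagger)$ and $\mathcal{R}((B^*-A^* )^\dagger)=\mathcal{R}((B^* )^\dagger-(A^* )^\dagger)$. Then $A\overset{-}{\leq}B$ if and only if $A^\dagger\overset{-}{\leq}B^\dagger$.
   Context: $\mathcal{H}$ is a complex Hilbert space, $\mathcal{L}(\mathcal{H})$ is the algebra of bounded linear operators on $\mathcal{H}$, and $\mathcal{R}(T)$, $\mathcal{N}(T)$ denote range and nullspace. The Moore-Penrose inverse of $T\in\mathcal{L}(\mathcal{H})$ is the (in general densely defined, unbounded) operator $T^\dagger:\mathcal{R}(T)\oplus\mathcal{R}(T)^\perp\to\mathcal{H}$ with $T^\dagger|_{\mathcal{R}(T)}=(T|_{\mathcal{N}(T)^\perp})^{-1}$ (where $T|_{\mathcal{N}(T)^\perp}:\mathcal{N}(T)^\perp\to\mathcal{R}(T)$) and $\mathcal{N}(T^\dagger)=\mathcal{R}(T)^\perp$; $T^\dagger\in\mathcal{L}(\mathcal{H})$ if and only if $\mathcal{R}(T)$ is closed. Minus order: for $A,B\in\mathcal{L}(\mathcal{H})$, $A\overset{-}{\leq}B$ if there exist idempotents $P,Q\in\mathcal{L}(\mathcal{H})$ such that $A=PB$ and $A^*=QB^*$. *)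

(* Defs.v *)
From HB Require Import structures.
From mathcomp Require Import all_boot all_order all_algebra.
From mathcomp Require Import complex.
From mathcomp Require Import all_classical all_reals all_analysis.

Set Implicit Arguments.
Unset Strict Implicit.
Unset Printing Implicit Defensive.

Import Order.TTheory GRing.Theory Num.Theory.
Import numFieldNormedType.Exports.

Local Open Scope classical_set_scope.
Local Open Scope ring_scope.

Section HilbertSpaceOperators.
Context {R : realType} {H : completeNormedModType R[i]}.
Implicit Types (T A B P Q : H -> H) (S : set H).

(* A complex Hilbert space is a complete normed space over R[i] whose norm
   comes from an inner product (linear in its first argument). *)
Definition induces_norm (dot : {dot H for Num.conj}) :=
  forall x : H, `|x| ^+ 2 = dot x x.

Definition bounded_op T :=
  linear T /\ exists M : R, forall x, `|T x| <= M%:C%C * `|x|.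

Definition nullspace T : set H := [set x | T x = 0].

Variable dot : {dot H for Num.conj}.

Definition orthocompl S : set H := [set x | forall y, S y -> dot x y = 0].

(* For a bounded operator T, the vector z exists by the Riesz representation
   theorem and is unique; 0 is a junk value for other T. *)
Definition adjoint T : H -> H :=
  fun y => xget 0 [set z | forall x, dot (T x) y = dot x z].

(* The Moore-Penrose inverse of T is the partial operator given by the domain
   [mpinv_dom T] and the function [mpinv T], whose value outside of this domain
   is the junk value 0. The domain is the whole space when the range of T is
   closed. *)
Definition mpinv_dom T : set H :=
  [set y | exists r s, [/\ range T r, orthocompl (range T) s & y = r + s]].

(* On the range of T it is the inverse of the restriction of T to the
   orthogonal complement of its nullspace, and it kills the orthogonal
   complement of the range of T. *)
Definition mpinv T : H -> H :=
  fun y => xget 0 [set x | exists r s,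
    [/\ range T r, orthocompl (range T) s, y = r + s &
        x = 'pinv_(fun=> 0) (orthocompl (nullspace T)) T r]].

Definition mpinv_range T : set H := mpinv T @` mpinv_dom T.

Definition minus_le A B :=
  exists P Q, [/\ bounded_op P /\ idempotent_fun P, bounded_op Q /\ idempotent_fun Q,
                  A = P \o B & adjoint A = Q \o adjoint B].

End HilbertSpaceOperators.

(* Main.v *)
Require Import Defs.
From HB Require Import structures.
From mathcomp Require Import all_boot all_order all_algebra.
From mathcomp Require Import complex.
From mathcomp Require Import all_classical all_reals all_analysis.
From mathcomp Require Import ring lra.

Set Implicit Arguments.
Unset Strict Implicit.
Unset Printing Implicit Defensive.

Import Order.TTheory GRing.Theory Num.Theory.
Import numFieldNormedType.Exports.
Import Normc.

Local Open Scope classical_set_scope.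
Local Open Scope ring_scope.

(** For operators with an idempotent [P], the equation [a = P \o b] says
    exactly that [P] is the identity on the range of [a] and vanishes on the
    range of [b - a].  For a bounded [P] both conditions pass from a set to its
    closed linear span, that is, to its double orthogonal complement
    ([eq_on_biorthocompl]).  Hence [a = P \o b] depends only on the closures of
    the two ranges, and it can be carried over to any other pair [a', b'] whose
    ranges [R(a')] and [R(b' - a')] are those closures
    ([idempotent_comp_iff]).

    The range of [mpinv A] is [N(A)^perp], the closure of [R(A^* )], and by
    hypothesis the range of [mpinv B - mpinv A] is the range of
    [mpinv (B - A)], namely [N(B - A)^perp], the closure of [R(B^* - A^* )].
    So the same [Q] witnesses [A^* = Q B^*] and [mpinv A = Q (mpinv B)].
    The other hypothesis shows likewise that the same [P] witnesses [A = P B]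
    and [mpinv (A^* ) = P (mpinv (B^* ))].  Since
    [mpinv (A^* ) = (mpinv A)^*], exchanging [P] and [Q] turns a witness of
    one minus relation into a witness of the other.

    The analytic content lies in the identity [mpinv (A^* ) = (mpinv A)^*]
    ([adjoint_pair_mpinv]).  It follows by a direct computation once every
    vector splits along [R(A)] and its orthogonal complement, and also along
    [R(A^* )] and its orthogonal complement; the second splitting needs the
    closed range theorem ([closed_range_adjoint]).  That theorem is derived from
    a Hilbert space form of the uniform boundedness principle
    ([weakly_bounded_bounded]): when [R(A)] is closed, the vectors [z] of
    [R(A)] with [|A^* z| <= 1] form a weakly bounded set, so it is bounded, which
    means that [A^*] is bounded below on [R(A)] and has closed range. *)

(** * The real-valued norm and the inner product *)

Section HilbertGeometry.
Context {R : realType} {H : completeNormedModType R[i]}.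
Implicit Types (x y z : H) (a b c : R[i]).

(** Norms over [R[i]] take their values in [R[i]], whose order is partial;
    [rnorm] takes them in [R], where estimates can be carried out. *)
Definition rnorm x : R := complex.Re `|x|.

Lemma rnormE x : `|x| = (rnorm x)%:C%C.
Proof. by rewrite /rnorm RRe_real// normr_real. Qed.

Lemma normr_normc a : `|a| = (normc a)%:C%C.
Proof. by case: a. Qed.

Lemma rnorm_ge0 x : 0 <= rnorm x.
Proof. by rewrite -ler0c -rnormE. Qed.

Lemma normc_ge0 a : 0 <= normc a.
Proof. by rewrite -ler0c -normr_normc. Qed.

Lemma rnormD x y : rnorm (x + y) <= rnorm x + rnorm y.
Proof. by rewrite -lecR rmorphD /= -!rnormE ler_normD. Qed.

Lemma rnormZ a x : rnorm (a *: x) = normc a * rnorm x.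
Proof. by apply: (@complexI R); rewrite rmorphM /= -!rnormE -normr_normc normrZ. Qed.

Lemma rnormN x : rnorm (- x) = rnorm x.
Proof. by rewrite /rnorm normrN. Qed.

Lemma rnorm0_eq0 x : rnorm x = 0 -> x = 0.
Proof. by move=> x0; apply/eqP; rewrite -normr_eq0 rnormE x0. Qed.

Lemma rnorm0 : rnorm 0 = 0.
Proof. by rewrite /rnorm normr0. Qed.

Lemma rdistD y x z : rnorm (x - z) <= rnorm (x - y) + rnorm (y - z).
Proof. by rewrite (le_trans _ (rnormD _ _))// addrA subrK. Qed.

Lemma rdistC x y : rnorm (x - y) = rnorm (y - x).
Proof. by rewrite -opprB rnormN. Qed.

Lemma normcR (r : R) : normc r%:C%C = `|r|.
Proof. by rewrite /= expr0n /= addr0 sqrtr_sqr. Qed.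

Lemma closed_adherentP (S : set H) : closed S <->
  forall l, (forall e : R, 0 < e -> exists2 y, S y & rnorm (y - l) < e) -> S l.
Proof.
split=> [/closure_id cS l adh|cS].
  rewrite cS => B /nbhs_normP[e /= e0 eB].
  have eE : e = (complex.Re e)%:C%C by rewrite RRe_real// gtr0_real.
  have [|y Sy yl] := adh (complex.Re e); first by rewrite -ltcR -eE.
  exists y; split=> //; apply: eB => /=.
  by rewrite distrC rnormE eE ltcR.
apply/closure_id; apply/seteqP; split; first exact: subset_closure.
move=> l cl; apply: cS => e e0.
have [|y [Sy yl]] := cl (ball l e%:C%C); first by apply: nbhsx_ballx; rewrite ltcR.
exists y => //; move: yl; rewrite -ball_normE /= distrC rnormE ltcR//.
Qed.

Lemma rnorm_complete (u : nat -> H) :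
  (forall e : R, 0 < e -> exists N, forall m n, (N <= m)%N -> (N <= n)%N ->
     rnorm (u m - u n) < e) ->
  exists l, forall e : R, 0 < e -> exists N, forall n, (N <= n)%N ->
     rnorm (u n - l) < e.
Proof.
move=> cu.
have : cvg (u @ \oo).
  apply/cauchy_cvgP; apply: cauchy_exP => e e0.
  have eE : e = (complex.Re e)%:C%C by rewrite RRe_real// gtr0_real.
  have [|N uN] := cu (complex.Re e); first by rewrite -ltcR -eE.
  exists (u N), N => // n /= Nn; rewrite -ball_normE /= rnormE eE ltcR.
  exact: uN.
move=> /cvg_ex[l /cvgrPdist_lt ul]; exists l => e e0.
have [|N _ uN] := ul e%:C%C; first by rewrite ltcR.
exists N => n /uN /=; rewrite rnormE ltcR rdistC//.
Qed.

Variable dot : {dot H for Num.conj}.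
Hypothesis normH : induces_norm dot.

Lemma dotC x y : dot x y = (dot y x)^*%R.
Proof. by rewrite hermC /= expr0 mul1r. Qed.

Lemma dotDl x y z : dot (x + y) z = dot x z + dot y z.
Proof. exact: linearDl. Qed.
Lemma dotDr x y z : dot x (y + z) = dot x y + dot x z.
Proof. exact: linearDr. Qed.
Lemma dotNl x y : dot (- x) y = - dot x y.
Proof. exact: linearNl. Qed.
Lemma dotNr x y : dot x (- y) = - dot x y.
Proof. exact: linearNr. Qed.
Lemma dotBl x y z : dot (x - y) z = dot x z - dot y z.
Proof. exact: linearBl. Qed.
Lemma dotBr x y z : dot x (y - z) = dot x y - dot x z.
Proof. exact: linearBr. Qed.
Lemma dotZl a x y : dot (a *: x) y = a * dot x y.
Proof. exact: linearZl_LR. Qed.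
Lemma dotZr a x y : dot x (a *: y) = a^*%R * dot x y.
Proof. exact: linearZr_LR. Qed.
Lemma dot0l x : dot 0 x = 0. Proof. exact: linear0l. Qed.
Lemma dot0r x : dot x 0 = 0. Proof. exact: linear0r. Qed.

Lemma dotxx x : dot x x = (rnorm x ^+ 2)%:C%C.
Proof. by rewrite -normH rnormE rmorphXn. Qed.

Lemma dotxx_eq0 x : dot x x = 0 -> x = 0.
Proof.
by rewrite dotxx => /(@complexI R)/eqP; rewrite sqrf_eq0 => /eqP/rnorm0_eq0.
Qed.

Lemma dot_eq0C x y : dot x y = 0 -> dot y x = 0.
Proof. by rewrite dotC => h; rewrite -[dot y x]conjCK h conjC0. Qed.

Lemma parallelogram x y : rnorm (x + y) ^+ 2 + rnorm (x - y) ^+ 2 =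
  2 * rnorm x ^+ 2 + 2 * rnorm y ^+ 2.
Proof.
apply: (@complexI R); rewrite !rmorphD /= !(rmorphM _ 2) /= rmorph_nat -!dotxx.
by rewrite !(dotDl, dotDr, dotNl, dotNr); ring.
Qed.

(** This identity, applied to the component of [x] orthogonal to [y], gives both
    the Cauchy-Schwarz inequality and the orthogonality of nearest points. *)
Lemma rnorm_sub_proj x y : y != 0 ->
  rnorm (x - (dot x y / dot y y) *: y) ^+ 2 =
  rnorm x ^+ 2 - normc (dot x y) ^+ 2 / rnorm y ^+ 2.
Proof.
move=> y0; apply: (@complexI R).
have yy0 : dot y y != 0 by apply: contra y0 => /eqP/dotxx_eq0->.
rewrite -dotxx rmorphB /= -dotxx fmorph_div /= -dotxx rmorphXn /= -normr_normc.
rewrite normCK !(dotBl, dotBr, dotZl, dotZr) -(dotC y x) rmorphM fmorphV /= -(dotC y).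
rewrite (dotC y y) conjCK -?(dotC y y).
by field.
Qed.

Lemma normc_dot_le x y : normc (dot x y) <= rnorm x * rnorm y.
Proof.
have [->|y0] := eqVneq y 0; first by rewrite dot0r normc0 rnorm0 mulr0.
have yp : 0 < rnorm y ^+ 2.
  rewrite exprn_gt0// lt_def rnorm_ge0 andbT.
  by apply: contra y0 => /eqP/rnorm0_eq0->.
have := sqr_ge0 (rnorm (x - (dot x y / dot y y) *: y)).
rewrite rnorm_sub_proj// subr_ge0 ler_pdivrMr// -exprMn.
by rewrite ler_pXn2r// nnegrE ?mulr_ge0 ?normc_ge0 ?rnorm_ge0.
Qed.

End HilbertGeometry.

(** * Orthogonal projection onto a closed subspace *)

Lemma invS_lt_near (R : realType) (e : R) : 0 < e ->
  exists N, forall n, (N <= n)%N -> (n.+1%:R : R)^-1 < e.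
Proof.
move=> e0; exists (Num.truncn e^-1) => n Nn.
by rewrite invf_plt ?posrE// (lt_le_trans (truncnS_gt _))// ler_nat ltnS.
Qed.

Section Projection.
Context {R : realType} {H : completeNormedModType R[i]}.
Variable dot : {dot H for Num.conj}.
Hypothesis normH : induces_norm dot.
Implicit Types (x y z : H) (S : set H).

Definition lin_subspace S := S 0 /\ forall a x y, S x -> S y -> S (a *: x + y).

Lemma lin_subspaceD S x y : lin_subspace S -> S x -> S y -> S (x + y).
Proof. by move=> [_ SD] Sx Sy; rewrite -[x]scale1r; exact: SD. Qed.

Lemma lin_subspaceZ S a x : lin_subspace S -> S x -> S (a *: x).
Proof. by move=> [S0 SD] Sx; rewrite -[_ *: _]addr0; exact: SD. Qed.

Lemma lin_subspaceB S x y : lin_subspace S -> S x -> S y -> S (x - y).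
Proof. by move=> [_ SD] Sx Sy; rewrite addrC -scaleN1r; exact: SD. Qed.

(** If [x - p] had a component along some [s] in [S], moving [p] along [s] would
    bring it strictly closer to [x]. *)
Lemma nearest_point_ortho S x p : lin_subspace S -> S p ->
  (forall s, S s -> rnorm (x - p) <= rnorm (x - s)) ->
  orthocompl dot S (x - p).
Proof.
move=> linS Sp pmin s Ss; have [->|s0] := eqVneq s 0; first exact: dot0r.
have s2p : 0 < rnorm s ^+ 2.
  rewrite exprn_gt0// lt_def rnorm_ge0 andbT.
  by apply: contra s0 => /eqP/rnorm0_eq0->.
set c := dot (x - p) s / dot s s.
have : rnorm (x - p) ^+ 2 <= rnorm (x - p - c *: s) ^+ 2.
  rewrite ler_pXn2r ?nnegrE ?rnorm_ge0// -addrA -opprD; apply: pmin.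
  by apply: lin_subspaceD => //; exact: lin_subspaceZ.
rewrite (rnorm_sub_proj normH) // lerBrDr gerDl pmulr_lle0 ?invr_gt0//.
by rewrite exprn_even_le0//= => /eqP/eq0_normc.
Qed.

(** A minimising sequence for the distance from [x] to [S] is Cauchy by the
    parallelogram identity, and its limit is a nearest point. *)
Theorem orthogonal_projection S x : lin_subspace S -> closed S ->
  exists2 p, S p & orthocompl dot S (x - p).
Proof.
move=> linS /closed_adherentP clS; have [S0 _] := linS.
pose D := [set rnorm (x - s) | s in S].
have infD : has_inf D.
  split; first by exists (rnorm (x - 0)), 0.
  by exists 0 => _ [s _ <-]; exact: rnorm_ge0.
pose d := inf D.
have d_le s : S s -> d <= rnorm (x - s).
  by move=> Ss; apply: ge_inf; [exact: infD.2 | exists s].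
have d_ge0 : 0 <= d.
  by apply: lb_le_inf; [exact: infD.1 | move=> _ [s _ <-]; exact: rnorm_ge0].
have near_d (e : R) : 0 < e -> exists2 s, S s & rnorm (x - s) < d + e.
  move=> e0; have [_ [s Ss <-] se] := inf_adherent e0 infD.
  by exists s.
(* The midpoint of s and t lies in S, hence at distance at least d from x. *)
have near_diam (e : R) s t : 0 < e -> S s -> S t ->
    rnorm (x - s) < d + e -> rnorm (x - t) < d + e ->
    rnorm (s - t) ^+ 2 <= 4 * (2 * d * e + e ^+ 2).
  move=> e0 Ss St xs xt.
  have := parallelogram normH (x - t) (x - s).
  have -> : x - t - (x - s) = s - t by rewrite opprB addrC addrA subrK.
  have -> : x - t + (x - s) = (2%:R : R[i]) *: (x - (2%:R : R[i])^-1 *: (s + t)).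
    rewrite scalerBr scalerA divff ?pnatr_eq0// scale1r scaler_nat mulr2n.
    by rewrite addrACA -opprD (addrC t).
  have m_d : d <= rnorm (x - (2%:R : R[i])^-1 *: (s + t)).
    by apply: d_le; apply: lin_subspaceZ => //; exact: lin_subspaceD.
  rewrite rnormZ (_ : normc 2%:R = 2); last first.
    by rewrite -(rmorph_nat (real_complex R)) normcR ger0_norm.
  have xs0 := rnorm_ge0 (x - s); have xt0 := rnorm_ge0 (x - t).
  nra.
have /choice[u uP] : forall n : nat, exists s,
    S s /\ rnorm (x - s) < d + n.+1%:R^-1.
  by move=> n; have [|s Ss sd] := near_d n.+1%:R^-1; [|exists s].
have [l ul] : exists l, forall e : R, 0 < e -> exists N, forall n, (N <= n)%N ->
    rnorm (u n - l) < e.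
  apply: rnorm_complete => e e0.
  (* With r <= 1 one has 4 * (2 * d * r + r ^ 2) < r * (8 * d + 8) <= e ^ 2. *)
  pose r := Num.min 1 (e ^+ 2 / (8 * d + 8)).
  have q0 : 0 < 8 * d + 8 by lra.
  have r0 : 0 < r by rewrite lt_min ltr01/= divr_gt0// exprn_gt0.
  have [N Nr] := @invS_lt_near R r r0; exists N => m n Nm Nn.
  have [Sm um] := uP m; have [Sn un] := uP n.
  have dr k : (N <= k)%N -> d + k.+1%:R^-1 < d + r by move=> /Nr kr; rewrite ltrD2l.
  have := near_diam r _ _ r0 Sm Sn (lt_trans um (dr _ Nm)) (lt_trans un (dr _ Nn)).
  have r1 : r <= 1 by rewrite ge_min lexx.
  have : r * (8 * d + 8) <= e ^+ 2.
    by rewrite -ler_pdivlMr// ge_min lexx orbT.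
  rewrite -(@ltr_pXn2r _ 2) ?nnegrE ?rnorm_ge0 ?(ltW e0)//; nra.
have Sl : S l.
  apply: clS => e /ul[N uN]; exists (u N); first by have [] := uP N.
  exact: uN.
exists l => //; apply: nearest_point_ortho => // s Ss.
apply: le_trans (d_le _ Ss); apply/ler_addgt0Pr => e e0.
have e2 : 0 < e / 2 by rewrite divr_gt0.
have [N Ne] := invS_lt_near e2; have [M uM] := ul _ e2.
have [_ /ltW ud] := uP (maxn N M).
apply: le_trans (rdistD (u (maxn N M)) x l) _.
rewrite [e]splitr addrA lerD ?(ltW (uM _ (leq_maxr _ _)))//.
by rewrite (le_trans ud)// lerD2l (ltW (Ne _ (leq_maxl _ _))).
Qed.

Lemma orthocompl_subspace S : lin_subspace (orthocompl dot S).
Proof.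
split=> [y _|a x y Sx Sy s Ss]; first exact: dot0l.
by rewrite dotDl dotZl Sx// Sy// mulr0 addr0.
Qed.

Lemma orthocompl_disjoint S x : S x -> orthocompl dot S x -> x = 0.
Proof. by move=> Sx /(_ x Sx); exact: dotxx_eq0. Qed.

Lemma orthocompl2 S : S `<=` orthocompl dot (orthocompl dot S).
Proof. by move=> x Sx y /(_ x Sx); exact: dot_eq0C. Qed.

End Projection.

(** * The Riesz representation theorem and adjoints *)

Section Adjoint.
Context {R : realType} {H : completeNormedModType R[i]}.
Variable dot : {dot H for Num.conj}.
Hypothesis normH : induces_norm dot.
Implicit Types (x y z : H) (S : set H) (T : H -> H).

Lemma linop0 T : linear T -> T 0 = 0.
Proof. by move=> linT; rewrite -[0 in LHS](addNr 0) -scaleN1r linT scaleN1r addNr. Qed.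

Lemma linopZ T a x : linear T -> T (a *: x) = a *: T x.
Proof. by move=> linT; rewrite -[_ *: x]addr0 linT linop0// addr0. Qed.

Lemma linopB T x y : linear T -> T (x - y) = T x - T y.
Proof. by move=> linT; rewrite addrC -scaleN1r linT scaleN1r addrC. Qed.

Lemma nullspace_subspace T : linear T -> lin_subspace (nullspace T).
Proof.
by move=> linT; split=> [|a x y]; rewrite /nullspace/= ?linop0// linT => -> ->;
  rewrite scaler0 addr0.
Qed.

Lemma range_subspace T : linear T -> lin_subspace (range T).
Proof.
move=> linT; split=> [|a _ _ [x _ <-] [y _ <-]]; first by exists 0; rewrite ?linop0.
by exists (a *: x + y); rewrite ?linT.
Qed.

Lemma bounded_op_rnorm T : bounded_op T ->
  exists2 M : R, 0 <= M & forall x, rnorm (T x) <= M * rnorm x.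
Proof.
move=> [_ [M TM]]; exists `|M| => // x.
apply: (@le_trans _ _ (M * rnorm x)).
  by rewrite -lecR rmorphM/= -!rnormE.
by rewrite ler_wpM2r ?rnorm_ge0// ler_norm.
Qed.

Lemma bounded_op_of_rnorm T (M : R) : linear T ->
  (forall x, rnorm (T x) <= M * rnorm x) -> bounded_op T.
Proof.
by move=> linT TM; split=> //; exists M => x; rewrite !rnormE -rmorphM lecR.
Qed.

Definition linear_form (f : H -> R[i]) := forall a x y, f (a *: x + y) = a * f x + f y.

Lemma linear_form0 f : linear_form f -> f 0 = 0.
Proof. by move=> linf; rewrite -[0 in LHS](addNr 0) -scaleN1r linf mulN1r addNr. Qed.

Lemma linear_formB f x y : linear_form f -> f (x - y) = f x - f y.
Proof. by move=> linf; rewrite addrC -scaleN1r linf mulN1r addrC. Qed.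

Lemma closed_kernel f (M : R) : linear_form f ->
  (forall x, normc (f x) <= M * rnorm x) -> closed [set x | f x = 0].
Proof.
move=> linf fM; apply/closed_adherentP => l adh; apply: eq0_normc.
apply/eqP; rewrite eq_le normc_ge0 andbT leNgt; apply/negP => fl.
have M0 : 0 < M.
  have := lt_le_trans fl (fM l); rewrite ltNge; apply: contraTT; rewrite -leNgt => M0.
  by rewrite mulr_le0_ge0 ?rnorm_ge0.
have [|y /= fy] := adh (normc (f l) / M); first by rewrite divr_gt0.
rewrite ltr_pdivlMr// ltNge mulrC => /negP; apply.
by rewrite (le_trans _ (fM _))// linear_formB// fy sub0r normcN.
Qed.

Lemma orthocompl_closed S : closed (orthocompl dot S).
Proof.
have -> : orthocompl dot S = \bigcap_(s in S) [set x | dot x s = 0].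
  by apply/seteqP; split.
apply: closed_bigI => s _; apply: (@closed_kernel _ (rnorm s)) => [a x y|x].
  by rewrite dotDl dotZl.
by rewrite mulrC; exact: normc_dot_le.
Qed.

(** A nonzero [w] orthogonal to the kernel of [f] spans its orthogonal
    complement, because every [x] equals a multiple of [w] up to the kernel. *)
Theorem riesz f (M : R) : linear_form f ->
  (forall x, normc (f x) <= M * rnorm x) -> exists z, forall x, f x = dot x z.
Proof.
move=> linf fM; set K := [set x | f x = 0].
have [f0|/existsNP[w0 /eqP fw0]] := pselect (forall x, f x = 0).
  by exists 0 => x; rewrite f0 dot0r.
have linK : lin_subspace K.
  split=> [|a x y]; rewrite /K /= ?linear_form0// linf => -> ->.
  by rewrite mulr0 addr0.
have [p Kp] := orthogonal_projection normH w0 linK (closed_kernel linf fM).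
set w := w0 - p => Kw.
have fw : f w != 0 by rewrite linear_formB// [f p]Kp subr0.
have w0' : dot w w != 0.
  by apply: contra fw => /eqP/(dotxx_eq0 normH)->; rewrite linear_form0.
exists ((f w / dot w w)^*%R *: w) => x.
rewrite dotZr conjCK.
have : K (x - (f x / f w) *: w).
  rewrite /K /= linear_formB// -[_ *: w]addr0 linf linear_form0// addr0.
  by rewrite divfK// subrr.
move=> /Kw/dot_eq0C; rewrite dotBl dotZl => /subr0_eq ->.
by field; rewrite fw w0'.
Qed.

(** Mutual adjointness as a relation: unlike the function [adjoint], it is
    symmetric and makes sense for operators not known to be bounded, such as
    Moore-Penrose inverses. *)
Definition adjoint_pair T T' := forall x y, dot (T x) y = dot x (T' y).

Lemma dot_inj x y : (forall z, dot z x = dot z y) -> x = y.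
Proof.
move=> xy; apply/eqP; rewrite -subr_eq0; apply/eqP/(dotxx_eq0 normH).
by rewrite dotBr xy subrr.
Qed.

Lemma adjoint_pairE T T' : adjoint_pair T T' -> adjoint dot T = T'.
Proof.
move=> TT'; apply/funext => y; apply: xget_unique => [x|z /= zP]; first exact: TT'.
by apply: dot_inj => x; rewrite -zP TT'.
Qed.

Lemma adjoint_pairC T T' : adjoint_pair T T' -> adjoint_pair T' T.
Proof. by move=> TT' x y; rewrite dotC -TT' -dotC. Qed.

Lemma adjointP T : bounded_op T -> adjoint_pair T (adjoint dot T).
Proof.
move=> bT x y; have [linT _] := bT; have [M M0 TM] := bounded_op_rnorm bT.
have [a u v|u|z zP] := @riesz (fun x => dot (T x) y) (M * rnorm y).
- by rewrite linT dotDl dotZl.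
- rewrite (le_trans (normc_dot_le normH _ _))// mulrAC.
  by rewrite ler_wpM2r ?rnorm_ge0.
exact: (@xgetI _ 0 [set z | forall x, dot (T x) y = dot x z] z zP).
Qed.

Lemma adjoint_pair_linear T T' : adjoint_pair T T' -> linear T'.
Proof.
move=> TT' a x y; apply: dot_inj => z.
by rewrite -TT' !dotDr !dotZr !TT'.
Qed.

(** From [|T' y| ^ 2 = <T (T' y), y> <= M |T' y| |y|]. *)
Lemma adjoint_pair_bounded T T' : adjoint_pair T T' -> bounded_op T -> bounded_op T'.
Proof.
move=> TT' /bounded_op_rnorm[M M0 TM].
apply: (bounded_op_of_rnorm (M := M)) => [|y]; first exact: adjoint_pair_linear TT'.
have [->|T'y] := eqVneq (rnorm (T' y)) 0; first by rewrite mulr_ge0 ?rnorm_ge0.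
have T'y0 : 0 < rnorm (T' y) by rewrite lt_def T'y rnorm_ge0.
rewrite -(ler_pM2r T'y0) -expr2 -[_ ^+ 2]ger0_norm ?sqr_ge0// -normcR -(dotxx normH).
rewrite -TT' (le_trans (normc_dot_le normH _ _))// mulrAC ler_wpM2r ?rnorm_ge0//.
Qed.

Lemma nullspace_adjoint T T' : adjoint_pair T T' ->
  nullspace T' = orthocompl dot (range T).
Proof.
move=> TT'; apply/seteqP; split=> [y T'y _ [x _ <-]|y yT].
  by apply: dot_eq0C; rewrite TT' [T' y]T'y dot0r.
apply: dot_inj => x; rewrite -TT' dot0r; apply: dot_eq0C.
by apply: yT; exists x.
Qed.

End Adjoint.

(** * Uniform boundedness and the closed range theorem *)

Section ClosedRange.
Context {R : realType} {H : completeNormedModType R[i]}.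
Variable dot : {dot H for Num.conj}.
Hypothesis normH : induces_norm dot.
Implicit Types (x y z : H) (S W : set H) (T : H -> H).

(** Of the two points [x + e] and [x - e], with [e] a multiple of [z] of norm [r],
    one works: the difference of their products with [z] is twice [<e, z>]. *)
Lemma dot_push x z (r : R) : 0 <= r -> z != 0 ->
  exists2 x', rnorm (x' - x) <= r & r * rnorm z <= normc (dot x' z).
Proof.
move=> r0 z0; have nz0 : rnorm z != 0 by apply: contra z0 => /eqP/rnorm0_eq0->.
pose e := (r / rnorm z)%:C%C *: z.
have e_norm : rnorm e = r.
  by rewrite rnormZ normcR ger0_norm ?divfK// divr_ge0 ?rnorm_ge0.
have ez : normc (dot e z) = r * rnorm z.
  rewrite dotZl (dotxx normH) normcM !normcR ger0_norm ?divr_ge0 ?rnorm_ge0//.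
  by rewrite ger0_norm ?sqr_ge0// expr2 mulrA divfK.
have [xe|xe] := leP (r * rnorm z) (normc (dot (x + e) z)).
  by exists (x + e) => //; rewrite addrAC subrr add0r e_norm.
exists (x - e); first by rewrite addrAC subrr add0r rnormN e_norm.
have : dot (x + e) z - dot (x - e) z = dot e z + dot e z.
  by rewrite dotDl dotBl; ring.
move=> /(congr1 (@normc R)); rewrite -mulr2n normcMn ez => eE.
have := le_normcD (dot (x + e) z) (- dot (x - e) z).
rewrite normcN eE mulr2n => le2; rewrite leNgt; apply/negP => xe'.
by have := ltrD xe xe'; rewrite ltNge le2.
Qed.

(** The constant is the sum of the geometric series of ratio [1 / 3]. *)
Lemma geometric_steps_dist (u : nat -> H) :
  (forall n, rnorm (u n.+1 - u n) <= (3^-1 : R) ^+ n) ->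
  forall n k, rnorm (u (n + k)%N - u n) <= 3 / 2 * (3^-1 : R) ^+ n.
Proof.
move=> du n k; elim: k n => [|k IHk] n.
  by rewrite addn0 subrr rnorm0 mulr_ge0// exprn_ge0.
have := IHk n.+1; have := du n; have := rdistD (u n.+1) (u (n + k.+1)%N) (u n).
rewrite addSnnS exprS; lra.
Qed.

Lemma expV3_le n : (3^-1 : R) ^+ n <= n.+1%:R^-1.
Proof.
rewrite -[leRHS]mul1r ler_pdivlMr//.
elim: n => [|n]; first by rewrite expr0 mul1r.
have r0 : 0 <= (3^-1 : R) ^+ n by rewrite exprn_ge0.
move=> IHn; rewrite exprS -[n.+2%:R]natr1.
have := mulr_ge0 r0 (ler0n R n); move: IHn; rewrite -[n.+1%:R]natr1.
lra.
Qed.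

Lemma geometric_steps_cvg (u : nat -> H) :
  (forall n, rnorm (u n.+1 - u n) <= (3^-1 : R) ^+ n) ->
  exists l, forall n, rnorm (l - u n) <= 3 / 2 * (3^-1 : R) ^+ n.
Proof.
move=> /geometric_steps_dist du.
have [e e0|l ul] := @rnorm_complete R H u.
  have e3 : 0 < e / 3 by rewrite divr_gt0.
  have [N Ne] := invS_lt_near e3; exists N => m n Nm Nn.
  have rN := le_lt_trans (expV3_le N) (Ne N (leqnn N)).
  have := du N (m - N)%N; have := du N (n - N)%N; rewrite !subnKC//.
  have := rdistD (u N) (u m) (u n); rewrite (rdistC (u N)).
  lra.
exists l => n; apply/ler_addgt0Pr => e /ul[N uN].
have := uN (n + N)%N (leq_addl _ _); rewrite rdistC => /ltW lu.
rewrite (le_trans (rdistD (u (n + N)%N) _ _))// addrC lerD//.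
Qed.

(** Gliding hump argument.  If [W] is unbounded, pick [z n] in [W] of norm larger
    than [2 n 3 ^ n] and move from [u n] to [u n.+1] by at most [3 ^ - n], so that
    [|<u n.+1, z n>| >= 3 ^ - n |z n|].  All later steps together amount to at most
    half of this one, so the limit [l] satisfies [|<l, z n>| > n], against the
    weak boundedness of [W] at [l]. *)
Theorem weakly_bounded_bounded W :
  (forall u, exists C : R, forall z, W z -> normc (dot u z) <= C) ->
  exists C : R, forall z, W z -> rnorm z <= C.
Proof.
move=> weakW; apply: contrapT => /forallNP unbW.
pose r n : R := 3^-1 ^+ n.
have r_gt0 n : 0 < r n by rewrite exprn_gt0.
have /choice[f fP] : forall nx : nat * H, exists zx : H * H,
    [/\ W zx.1, nx.1%:R * 2 < r nx.1 * rnorm zx.1,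
        rnorm (zx.2 - nx.2) <= r nx.1 & r nx.1 * rnorm zx.1 <= normc (dot zx.2 zx.1)].
  move=> [n x] /=.
  have [z Wz zn] : exists2 z, W z & n%:R * 2 / r n < rnorm z.
    have /existsNP[z /not_implyP[Wz /negP]] := unbW (n%:R * 2 / r n).
    by rewrite -ltNge; exists z.
  have z0 : z != 0.
    apply: contraTneq zn => ->.
    by rewrite rnorm0 -leNgt divr_ge0 ?mulr_ge0// ltW.
  have [x' xx' x'z] := dot_push x (ltW (r_gt0 n)) z0.
  by exists (z, x'); split=> //=; rewrite [ltRHS]mulrC -ltr_pdivrMr.
pose u := fix u n := if n is m.+1 then (f (m, u m)).2 else 0.
pose z n := (f (n, u n)).1.
have [n|l lu] := @geometric_steps_cvg u; first by have [] := fP (n, u n).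
have [C lC] := weakW l.
have lz n : n%:R < normc (dot l (z n)).
  have [_] := fP (n, u n); rewrite -/(z n) -/(u n.+1) /= => zn _ uz.
  have := lu n.+1; rewrite exprS -/(r n) => lun.
  have := le_normcD (dot l (z n)) (- dot (l - u n.+1) (z n)).
  rewrite -dotBl opprB addrCA subrr addr0 normcN => tri.
  have := normc_dot_le normH (l - u n.+1) (z n).
  have := ler_wpM2r (rnorm_ge0 (z n)) lun.
  nra.
have := lC (z (Num.truncn C).+1); have [Wz _ _ _] := fP ((Num.truncn C).+1, u (Num.truncn C).+1).
move=> /(_ Wz) zC; have := lt_le_trans (lz _) zC.
by rewrite ltNge (ltW (truncnS_gt _)).
Qed.

(** Being bounded below, [T] reflects Cauchy sequences, so that limits of points
    of the image lift to limits in the closed set [S]. *)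
Lemma closed_image T S (M : R) : bounded_op T -> lin_subspace S -> closed S ->
  (forall z, S z -> rnorm z <= M * rnorm (T z)) -> closed (T @` S).
Proof.
move=> bT linS /closed_adherentP clS TM; apply/closed_adherentP => l adh.
have [linT _] := bT; have [N N0 TN] := bounded_op_rnorm bT.
have /choice[u uP] : forall n : nat, exists z, S z /\ rnorm (T z - l) < (n.+1%:R : R)^-1.
  by move=> n; have [|_ [z Sz <-] zl] := adh n.+1%:R^-1; [|exists z].
pose M' := `|M| + 1; have M'0 : 0 < M' by rewrite ltr_wpDl.
have SM' z : S z -> rnorm z <= M' * rnorm (T z).
  move=> /TM /le_trans-> //; rewrite ler_wpM2r ?rnorm_ge0//.
  by rewrite (le_trans (ler_norm _))// lerDl.
have [e e0|z uz] := @rnorm_complete R H u.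
  have e2 : 0 < e / M' / 2 by rewrite !divr_gt0.
  have [K Ke] := invS_lt_near e2; exists K => m n Km Kn.
  have [Sm Tm] := uP m; have [Sn Tn] := uP n.
  apply: le_lt_trans (SM' _ (lin_subspaceB linS Sm Sn)) _.
  rewrite mulrC -ltr_pdivlMr// linopB// (le_lt_trans (rdistD l _ _))//.
  rewrite [e / M']splitr (rdistC l) ltrD//; first exact: lt_trans Tm (Ke _ Km).
  exact: lt_trans Tn (Ke _ Kn).
have Sz : S z.
  by apply: clS => e /uz[K uK]; exists (u K); [have [] := uP K|exact: uK].
exists z => //; apply/eqP; rewrite -subr_eq0; apply/eqP/rnorm0_eq0/eqP.
rewrite eq_le rnorm_ge0 andbT; apply/ler_addgt0Pr => e e0; rewrite add0r.
have e2 : 0 < e / 2 by rewrite divr_gt0.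
have e2N : 0 < e / 2 / (N + 1) by rewrite divr_gt0// ltr_wpDl.
have [K Ke] := invS_lt_near e2; have [L uL] := uz _ e2N.
have [_ /ltW ul] := uP (maxn K L).
rewrite (le_trans (rdistD (T (u (maxn K L))) _ _))// [e]splitr lerD//.
  rewrite rdistC -linopB// (le_trans (TN _))//.
  have := uL _ (leq_maxr K L); rewrite ltr_pdivlMr ?ltr_wpDl// => /ltW.
  by apply: le_trans; rewrite mulrDr mulr1 mulrC lerDl rnorm_ge0.
exact: le_trans ul (ltW (Ke _ (leq_maxl _ _))).
Qed.

(** The points [z] of [range T] with [rnorm (T' z) <= 1] form a weakly bounded
    set: projecting [u] to some [T a] in [range T] gives
    [|<u, z>| = |<a, T' z>| <= |a|]. *)
Lemma closed_range_adjoint_bounded_below T T' : bounded_op T -> adjoint_pair dot T T' ->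
  closed (range T) ->
  exists M : R, forall z, range T z -> rnorm z <= M * rnorm (T' z).
Proof.
move=> [linT _] TT' clT; have linT' := adjoint_pair_linear normH TT'.
pose W := [set z | range T z /\ rnorm (T' z) <= 1].
have [u|M WM] := @weakly_bounded_bounded W.
  have [_ [a _ <-] sT] := orthogonal_projection normH u (range_subspace linT) clT.
  exists (rnorm a) => z [Tz T'z].
  have -> : dot u z = dot a (T' z).
    by rewrite -TT'; apply/eqP; rewrite -subr_eq0 -dotBl sT.
  rewrite (le_trans (normc_dot_le normH _ _))// -[leRHS]mulr1.
  by rewrite ler_wpM2l ?rnorm_ge0.
exists M => z Tz; have [T'z|T'z] := eqVneq (rnorm (T' z)) 0.
  rewrite T'z mulr0 (_ : z = 0) ?rnorm0//.
  apply: (orthocompl_disjoint normH Tz); rewrite -(nullspace_adjoint normH TT').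
  exact: rnorm0_eq0.
have T'z0 : 0 < rnorm (T' z) by rewrite lt_def T'z rnorm_ge0.
have := WM ((rnorm (T' z))^-1%:C%C *: z); rewrite rnormZ normcR ger0_norm ?invr_ge0 ?rnorm_ge0//.
rewrite mulrC ler_pdivrMr//; apply; split.
  by apply: lin_subspaceZ => //; exact: range_subspace.
by rewrite linopZ// rnormZ normcR ger0_norm ?invr_ge0 ?rnorm_ge0// mulVf.
Qed.

(** [T'] vanishes on the orthogonal complement of [range T], so its range is the
    image of [range T], on which it is bounded below. *)
Theorem closed_range_adjoint T T' : bounded_op T -> adjoint_pair dot T T' ->
  closed (range T) -> closed (range T').
Proof.
move=> bT TT' clT; have [linT _] := bT.
have linT' := adjoint_pair_linear normH TT'.
have [M TM] := closed_range_adjoint_bounded_below bT TT' clT.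
have -> : range T' = T' @` range T.
  apply/seteqP; split=> [_ [y _ <-]|_ [z _ <-]]; last by exists z.
  have [p Tp yp] := orthogonal_projection normH y (range_subspace linT) clT.
  exists p => //; apply/esym/eqP; rewrite -subr_eq0 -linopB//; apply/eqP.
  by move: yp; rewrite -(nullspace_adjoint normH TT').
apply: closed_image TM => //; last exact: range_subspace.
exact: adjoint_pair_bounded TT' bT.
Qed.

End ClosedRange.

(** * The Moore-Penrose inverse *)

Section MoorePenrose.
Context {R : realType} {H : completeNormedModType R[i]}.
Variable dot : {dot H for Num.conj}.
Hypothesis normH : induces_norm dot.
Implicit Types (x y z : H) (S : set H) (T : H -> H).

Local Notation perp := (orthocompl dot).

Lemma range_decomp T x : bounded_op T ->
  exists2 p, perp (nullspace T) p & T x = T p.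
Proof.
move=> bT; have [linT _] := bT.
have closedN : closed (nullspace T).
  by rewrite (nullspace_adjoint normH (adjoint_pairC (adjointP normH bT)));
    exact: orthocompl_closed.
have [q Tq xq] := orthogonal_projection normH x (nullspace_subspace linT) closedN.
by exists (x - q) => //; rewrite linopB// [T q]Tq subr0.
Qed.

Lemma closed_range_decomp T y : bounded_op T -> closed (range T) ->
  exists x s, [/\ perp (nullspace T) x, perp (range T) s & y = T x + s].
Proof.
move=> bT clT; have [linT _] := bT.
have [_ [w _ <-] yw] := orthogonal_projection normH y (range_subspace linT) clT.
have [p Np wp] := range_decomp w bT.
by exists p, (y - T w); split; rewrite // -wp addrC subrK.
Qed.

Lemma ortho_nullspace_inj T : linear T -> {in perp (nullspace T) &, injective T}.
Proof.
move=> linT x y /set_mem xN /set_mem yN Txy.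
apply/eqP; rewrite -subr_eq0; apply/eqP/(@orthocompl_disjoint _ _ _ normH (nullspace T)).
  by rewrite /nullspace /= linopB// Txy subrr.
exact: (lin_subspaceB (orthocompl_subspace dot _) xN yN).
Qed.

(** The components of [T x + s] along [range T] and its orthogonal complement are
    unique, and [T] is injective on the orthogonal complement of its nullspace. *)
Lemma mpinvE T x s : linear T -> perp (nullspace T) x -> perp (range T) s ->
  mpinv dot T (T x + s) = x.
Proof.
move=> linT xN sR.
have pinvx : 'pinv_(fun=> 0) (perp (nullspace T)) T (T x) = x.
  by apply: pinvKV; [exact: ortho_nullspace_inj | exact/mem_set].
apply: xget_unique; first by exists (T x), s; split=> //; exists x.
move=> _ [_ [s' [[w _ <-] s'R eq ->]]].
have Twx : T w - T x = s - s'.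
  by apply/eqP; rewrite subr_eq addrAC eq_sym subr_eq addrC eq addrC.
suff -> : T w = T x by [].
apply/eqP; rewrite -subr_eq0; apply/eqP/(@orthocompl_disjoint _ _ _ normH (range T)).
  by exists (w - x); rewrite ?linopB.
by rewrite Twx; exact: (lin_subspaceB (orthocompl_subspace dot _) sR s'R).
Qed.

Lemma mpinv_range_ortho T x : linear T -> perp (nullspace T) x -> mpinv dot T (T x) = x.
Proof.
move=> linT xN; rewrite -[T x]addr0 mpinvE//.
by have [] := orthocompl_subspace dot (range T).
Qed.

(** The junk value [0] outside the domain also lies in the subspace, so that [y]
    may be arbitrary. *)
Lemma mpinv_in_ortho T y : bounded_op T -> perp (nullspace T) (mpinv dot T y).
Proof.
move=> bT; have [linT _] := bT; rewrite /mpinv; case: xgetP => [_ -> /=|_].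
  move=> [_ [s [[w _ <-] _ _ ->]]]; have [p Np ->] := range_decomp w bT.
  by rewrite pinvKV//; [exact: ortho_nullspace_inj | exact/mem_set].
by have [] := orthocompl_subspace dot (nullspace T).
Qed.

Lemma mpinv_rangeE T : bounded_op T -> mpinv_range dot T = perp (nullspace T).
Proof.
move=> bT; have [linT _] := bT; apply/seteqP; split=> [_ [y _ <-]|x xN].
  exact: mpinv_in_ortho.
exists (T x); last exact: mpinv_range_ortho.
exists (T x), 0; split; [by exists x | | by rewrite addr0].
by have [] := orthocompl_subspace dot (range T).
Qed.

Lemma range_mpinv T : bounded_op T -> range (mpinv dot T) = perp (nullspace T).
Proof.
move=> bT; have [linT _] := bT; apply/seteqP; split=> [_ [y _ <-]|x xN].
  exact: mpinv_in_ortho.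
by exists (T x) => //; exact: mpinv_range_ortho.
Qed.

(** Write [x = T a + s] and [y = T' b + t] along the ranges of [T] and [T'] and
    their orthogonal complements, with [a] and [b] orthogonal to the nullspaces.
    Both sides then reduce to [<T a, b> = <a, T' b>]. *)
Theorem adjoint_pair_mpinv T T' : bounded_op T -> adjoint_pair dot T T' ->
  closed (range T) -> adjoint_pair dot (mpinv dot T) (mpinv dot T').
Proof.
move=> bT TT' clT x y; have [linT _] := bT.
have bT' := adjoint_pair_bounded normH TT' bT; have [linT' _] := bT'.
have clT' := closed_range_adjoint normH bT TT' clT.
have [a [s [aN sR ->]]] := closed_range_decomp x bT clT.
have [b [t [bN tR ->]]] := closed_range_decomp y bT' clT'.
rewrite !mpinvE// dotDl dotDr TT'.
rewrite -(nullspace_adjoint normH TT') in sR.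
rewrite -(nullspace_adjoint normH (adjoint_pairC TT')) in tR.
by rewrite (aN _ tR) (dot_eq0C (bN _ sR)).
Qed.

End MoorePenrose.

(** * The minus order *)

Section MinusOrder.
Context {R : realType} {H : completeNormedModType R[i]}.
Variable dot : {dot H for Num.conj}.
Hypothesis normH : induces_norm dot.
Implicit Types (x y z : H) (S : set H) (A B P T K : H -> H).

Local Notation perp := (orthocompl dot).

Lemma bounded_opB A B : bounded_op A -> bounded_op B -> bounded_op (B \- A).
Proof.
move=> bA bB; have [linA _] := bA; have [linB _] := bB.
have [M _ AM] := bounded_op_rnorm bA; have [N _ BN] := bounded_op_rnorm bB.
apply: (bounded_op_of_rnorm (M := N + M)) => [a x y|x] /=.
  by rewrite linA linB scalerBr opprD addrACA.
by rewrite (le_trans (rnormD _ _))// rnormN mulrDl lerD.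
Qed.

Lemma adjoint_pairB A A' B B' : adjoint_pair dot A A' -> adjoint_pair dot B B' ->
  adjoint_pair dot (B \- A) (B' \- A').
Proof. by move=> AA' BB' x y /=; rewrite dotBl dotBr AA' BB'. Qed.

(** For every [z] the vector [T' z - K' z] is orthogonal to [S], hence to
    [perp (perp S)].  With [K] the identity or zero, this extends from [S] to its
    closed span the property of being fixed or killed by [T]. *)
Lemma eq_on_biorthocompl S T T' K K' :
  adjoint_pair dot T T' -> adjoint_pair dot K K' ->
  (forall x, S x -> T x = K x) -> forall x, perp (perp S) x -> T x = K x.
Proof.
move=> TT' KK' TK x Sx; apply: (dot_inj normH) => z.
have -> : dot z (T x) = (dot x (T' z))^*%R by rewrite dotC TT'.
have -> : dot z (K x) = (dot x (K' z))^*%R by rewrite dotC KK'.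
congr (_^*)%R; apply/eqP; rewrite -subr_eq0 -dotBr; apply/eqP/Sx => s Ss.
by apply: dot_eq0C; rewrite dotBr -TT' -KK' TK// subrr.
Qed.

(** As [A = P \o B], the idempotent [P] fixes [range A] and kills
    [range (B \- A)]; it does the same on the double complements, hence on
    [A' x] and [B' x - A' x]. *)
Lemma idempotent_comp_biorthocompl P A B A' B' :
  bounded_op P -> idempotent_fun P ->
  range A' `<=` perp (perp (range A)) -> range (B' \- A') `<=` perp (perp (range (B \- A))) ->
  A = P \o B -> A' = P \o B'.
Proof.
move=> bP idP rA rE AE; have [linP _] := bP; have PP' := adjointP normH bP.
have PA' x : P (A' x) = A' x.
  apply: (@eq_on_biorthocompl (range A) P _ idfun idfun) => //; last first.
    by apply: rA; exists x.
  by move=> _ [z _ <-]; rewrite AE /= [P (P _)]idP.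
have PE x : P ((B' \- A') x) = 0.
  apply: (@eq_on_biorthocompl (range (B \- A)) P _ (fun=> 0) (fun=> 0)) => //.
  - by move=> u v; rewrite dot0l dot0r.
  - by move=> _ [z _ <-] /=; rewrite linopB// AE /= [P (P _)]idP subrr.
  - by apply: rE; exists x.
apply/funext => x /=; apply/eqP; rewrite eq_sym -subr_eq0 -(PA' x) -linopB//.
exact/eqP/PE.
Qed.

(** Under equalities the roles of the two pairs can be exchanged, since any set is
    contained in its double orthogonal complement. *)
Lemma idempotent_comp_iff P A B A' B' :
  bounded_op P -> idempotent_fun P ->
  range A' = perp (perp (range A)) -> range (B' \- A') = perp (perp (range (B \- A))) ->
  A = P \o B <-> A' = P \o B'.
Proof.
move=> bP idP rA rE; split; apply: idempotent_comp_biorthocompl => //.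
- by rewrite rA.
- by rewrite rE.
- by rewrite rA; do 2!apply: subset_trans (@orthocompl2 _ _ dot _).
- by rewrite rE; do 2!apply: subset_trans (@orthocompl2 _ _ dot _).
Qed.

End MinusOrder.

Theorem proposition4p10 (R : realType) (H : completeNormedModType R[i])
    (dot : {dot H for Num.conj}) (A B : H -> H) :
  induces_norm dot ->
  bounded_op A -> bounded_op B ->
  closed (range A) -> closed (range B) ->
  mpinv_range dot (B \- A) = range (mpinv dot B \- mpinv dot A) ->
  mpinv_range dot (adjoint dot B \- adjoint dot A) =
    range (mpinv dot (adjoint dot B) \- mpinv dot (adjoint dot A)) ->
  (minus_le dot A B <-> minus_le dot (mpinv dot A) (mpinv dot B)).
Proof.
move=> normH bA bB clA clB.
have adjA := adjointP normH bA; have adjB := adjointP normH bB.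
have bA' := adjoint_pair_bounded normH adjA bA.
have bB' := adjoint_pair_bounded normH adjB bB.
have rangeE T T' : adjoint_pair dot T T' -> orthocompl dot (nullspace T) =
    orthocompl dot (orthocompl dot (range T')).
  by move=> TT'; rewrite (nullspace_adjoint normH (adjoint_pairC TT')).
have bD := bounded_opB bA bB; have bD' := bounded_opB bA' bB'.
rewrite !(mpinv_rangeE normH)//.
rewrite (rangeE _ _ (adjoint_pairB adjA adjB)).
rewrite (rangeE _ _ (adjoint_pairC (adjoint_pairB adjA adjB))).
move=> /esym rE /esym rE'.
have rA := range_mpinv normH bA; rewrite (rangeE _ _ adjA) in rA.
have rA' := range_mpinv normH bA'; rewrite (rangeE _ _ (adjoint_pairC adjA)) in rA'.
rewrite /minus_le (adjoint_pairE normH (adjoint_pair_mpinv normH bA adjA clA)).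
rewrite (adjoint_pairE normH (adjoint_pair_mpinv normH bB adjB clB)).
have swap P bP idP := @idempotent_comp_iff _ _ _ normH P _ _ _ _ bP idP rA rE.
have swap' P bP idP := @idempotent_comp_iff _ _ _ normH P _ _ _ _ bP idP rA' rE'.
split=> -[P [Q [[bP idP] [bQ idQ] eP eQ]]]; exists Q, P; split=> //.
- exact/swap.
- exact/swap'.
- exact/swap'.
- exact/swap.
Qed.
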